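(* Let $\mathcal{T}$ be a staged tree. Then the staged tree model represented by $\mathcal{T}$ is a curved exponential family.
   Context: **Probability trees.** Let $\mathcal{T}$ be a finite directed rooted tree in which every vertex has either no or at least two emanating edges. The inner (non-leaf) vertices are $v_1,\dots,v_k$ ($k\ge 1$), with $v_1$ the root. The edges emanating from $v_i$ are indexed by $j=1,\dots,\kappa_i$. Each edge has a label $\theta_{ij}\in(0,1)$ with $\sum_{j=1}^{\kappa_i}\theta_{ij}=1$ for every $i$. A tree labelled in this way is a probability tree. For a root-to-leaf path $x$, put $p_\theta(x)=\prod_{i=1}^k\prod_{j=1}^{\kappa_i}\theta_{ij}^{\alpha_{ij}(x)}$, where $\alpha_{ij}(x)=1$ if $x$ passes through the $j$th edge emanating from $v_i$ and $\alpha_{ij}(x)=0$ otherwise. This is a probability distribution on the finite set $\mathcal X$ of root-to-leaf paths. The probability tree model is the set of all $p_\theta$ with $\theta$ ranging over the parameter space $\prod_{i=1}^k\Delta^\circ_{\kappa_i-1}$, where $\Delta^\circ_{m-1}=\{t\in\mathbb{R}^m\mid \sum_r t_r=1,\ 0<t_r<1 \text{ for all } r\}$. **Staged trees.** A staged tree is a probability tree together with an equivalence relation on its inner vertices, whose classes are called stages. Vertices in the same stage have the same number of emanating edges, and two vertices $v_i,v_s$ are in the same stage if and only if their outgoing edges have the same attached probabilities, $\theta_{ij}=\theta_{sj}$ for all $j$. The staged tree model is the submodel $\{p_\theta\}$ of the probability tree model consisting of those $\theta$ in which the simplices $\Delta^\circ_{\kappa_i-1}$ and $\Delta^\circ_{\kappa_s-1}$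 are identified (i.e. $\theta_{ij}=\theta_{sj}$ for all $j$) whenever $v_i$ and $v_s$ are in the same stage. **Exponential families.** A parametric model $\{p_\theta\mid\theta\in\Theta\}$ on $\mathcal X$ is an exponential family if every distribution in it can be written as $p_\theta(x)=h(x)\exp(\eta(\theta)^\top T(x)-\psi(\theta))$ for all $x\in\mathcal X$, where $\eta:\Theta\to\mathbb{R}^d$ is the canonical (natural) parameter, $T:\mathcal X\to\mathbb{R}^d$ is a minimally sufficient statistic and $\psi:\Theta\to\mathbb{R}$ is the cumulant-generating function. The natural parameter space is the set of those $\eta(\theta)\in\mathbb{R}^d$ for which the expression above is integrable. The family is a regular exponential family of dimension $d$ if its natural parameter space is a non-empty open subset of $\mathbb{R}^d$. A curved exponential family is a submodel of a regular exponential family whose parameter space, i.e. the set of natural parameters $\eta$ belonging to the distributions of the submodel, is a smooth manifold (a smooth submanifold of the natural parameter space of the regular family). *)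

(* Defs.v *)
From mathcomp Require Import all_boot all_order all_algebra.
From mathcomp Require Import all_classical all_reals all_analysis.

Set Implicit Arguments.
Unset Strict Implicit.
Unset Printing Implicit Defensive.

Import Order.TTheory GRing.Theory Num.Theory.
Import numFieldNormedType.Exports.

Local Open Scope classical_set_scope.
Local Open Scope ring_scope.

(** * Probability trees and staged trees *)

(* [kids v] lists the children of [v]; its [j]-th entry (from 0) is the head of
   the [j]-th edge emanating from [v].  Uniqueness of the directed path from
   the root to each vertex rules out cycles and unreachable vertices.
   [root_inner] says that there is at least one inner vertex. *)
Record rooted_tree := RootedTree {
  vertex :> finType;
  root : vertex;
  kids : vertex -> seq vertex;
  kids_uniq : forall v, uniq (kids v);
  root_path : forall v, exists! p : seq vertex,
    path (fun u w => w \in kids u) root p /\ last root p = v;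
  kids_neq1 : forall v, size (kids v) != 1%N;
  root_inner : kids root != [::] }.

Definition edge (T : rooted_tree) : rel T := fun u w => w \in kids u.

Definition inner (T : rooted_tree) : finType := {v : T | kids v != [::]}.

Definition kappa (T : rooted_tree) (v : inner T) : nat := size (kids (sval v)).

(* Root-to-leaf paths; the sequence [x] lists the vertices after the root.  The
   length bound, which makes this a finite type, excludes nothing: a path from
   the root visits each vertex at most once. *)
Definition leaf_path (T : rooted_tree) : finType :=
  {x : {bseq #|T| of T} |
    path (@edge T) (root T) x && (kids (last (root T) x) == [::])}.

Definition alpha (T : rooted_tree) (v : inner T) (j : 'I_(kappa v))
    (x : leaf_path T) : nat :=
  let s : seq T := sval x in
  (sval v, nth (root T) (kids (sval v)) j) \in zip (root T :: s) s.

Definition labelling (R : realType) (T : rooted_tree) : Type :=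
  forall v : inner T, 'I_(kappa v) -> R.

Definition open_simplex (R : realType) (m : nat) : set ('I_m -> R) :=
  [set t | \sum_(r < m) t r = 1 /\ forall r, 0 < t r < 1].

Definition tree_params (R : realType) (T : rooted_tree) :
    set (labelling R T) :=
  [set theta | forall v, open_simplex (theta v)].

Definition path_prob (R : realType) (T : rooted_tree) (theta : labelling R T)
    (x : leaf_path T) : R :=
  \prod_(v : inner T) \prod_(j < kappa v) theta v j ^+ alpha j x.

Definition same_labels (R : realType) (T : rooted_tree)
    (theta : labelling R T) (v s : inner T) : Prop :=
  kappa v = kappa s /\
  forall (j : 'I_(kappa v)) (j' : 'I_(kappa s)),
    j = j' :> nat -> theta v j = theta s j'.

Record staged_tree (R : realType) := StagedTree {
  tree :> rooted_tree;
  label : labelling R tree;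
  label_params : tree_params label;
  stage : rel (inner tree);
  stage_equiv : equivalence_rel stage;
  stageP : forall v s, stage v s <-> same_labels label v s }.

Definition staged_params (R : realType) (S : staged_tree R) :
    set (labelling R S) :=
  [set theta | tree_params theta /\
     forall v s, stage v s -> same_labels theta v s].

Definition staged_tree_model (R : realType) (S : staged_tree R) :
    set (leaf_path S -> R) :=
  [set path_prob theta | theta in @staged_params R S].

Arguments staged_tree_model {R} S.

(** * Exponential families on a finite sample space *)

(* [k x] is a version of the conditional probability of [x] given [S = S x]
   that serves every parameter simultaneously. *)
Definition sufficient (R : realType) (X : finType) (P : Type) (Theta : set P)
    (p : P -> X -> R) (Y : eqType) (S : X -> Y) : Prop :=
  exists k : X -> R, forall t x, Theta t ->
    p t x = k x * \sum_(y : X | S y == S x) p t y.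

Definition minimal_sufficient (R : realType) (X : finType) (P : Type)
    (Theta : set P) (p : P -> X -> R) (Y : eqType) (S : X -> Y) : Prop :=
  sufficient Theta p S /\
  forall (Z : eqType) (S' : X -> Z), sufficient Theta p S' ->
    exists f : Z -> Y, forall t x, Theta t -> 0 < p t x -> S x = f (S' x).

Definition dotp (R : realType) (d : nat) (u v : 'rV[R]_d) : R :=
  \sum_(i < d) u 0 i * v 0 i.

(* Since the densities sum to 1, [densityE] determines [cumulant] on the
   parameter space as the logarithm of the normalising constant. *)
Record exp_family (R : realType) (X : finType) (d : nat) := ExpFamily {
  param : Type;
  param_space : set param;
  density : param -> X -> R;
  base : X -> R;
  natural : param -> 'rV[R]_d;
  stat : X -> 'rV[R]_d;
  cumulant : param -> R;
  density_ge0 : forall t x, param_space t -> 0 <= density t x;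
  density_sum1 : forall t, param_space t -> \sum_(x : X) density t x = 1;
  densityE : forall t x, param_space t ->
    density t x = base x * expR (dotp (natural t) (stat x) - cumulant t);
  stat_minimal : minimal_sufficient param_space density stat }.

Arguments param_space {R X d} _.
Arguments density {R X d} _.
Arguments natural {R X d} _.
Arguments stat {R X d} _.
Arguments cumulant {R X d} _.
Arguments base {R X d} _.

(* Integrability is with respect to the counting measure on [X]; as [X] is
   finite, the condition always holds. *)
Definition natural_space (R : realType) (X : finType) (d : nat)
    (F : exp_family R X d) : set 'rV[R]_d :=
  [set natural F t | t in [set t | param_space F t /\
    (\sum_(x : X)
       `|base F x * expR (dotp (natural F t) (stat F x) - cumulant F t)|%:E
     < +oo)%E]].

Definition regular (R : realType) (X : finType) (d : nat)
    (F : exp_family R X d) : Prop :=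
  natural_space F !=set0 /\ open (natural_space F).

(** * Smooth submanifolds of Euclidean space *)

(* Partial derivatives of order up to [n] exist and are continuous on [U]; only
   meaningful for [U] open. *)
Fixpoint Ck (R : realType) (d n : nat) (U : set 'rV[R]_d)
    (f : 'rV[R]_d -> R) : Prop :=
  (forall x, U x -> {for x, continuous f}) /\
  if n is m.+1 then
    forall i : 'I_d,
      (forall x, U x -> derivable f x (delta_mx 0 i)) /\
      Ck m U (fun x => 'D_(delta_mx 0 i) f x)
  else True.

Definition smooth_on (R : realType) (d e : nat) (U : set 'rV[R]_d)
    (f : 'rV[R]_d -> 'rV[R]_e) : Prop :=
  forall (i : 'I_e) (n : nat), Ck n U (fun x => f x 0 i).

Definition diffeo (R : realType) (d : nat) (U V : set 'rV[R]_d)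
    (f g : 'rV[R]_d -> 'rV[R]_d) : Prop :=
  [/\ open U /\ open V,
      forall x, U x -> V (f x) /\ g (f x) = x,
      forall y, V y -> U (g y) /\ f (g y) = y,
      smooth_on U f & smooth_on V g].

(* Embedded submanifold of dimension [m], by slice charts: around each of its
   points [A] is straightened to the subspace where the coordinates of index at
   least [m] (counted from 0) vanish. *)
Definition smooth_submanifold (R : realType) (d : nat) (A : set 'rV[R]_d) :
    Prop :=
  exists2 m : nat, (m <= d)%N &
    forall a, A a -> exists (U V : set 'rV[R]_d) (f g : 'rV[R]_d -> 'rV[R]_d),
      [/\ U a, diffeo U V f g &
          forall x, U x ->
            (A x <-> forall i : 'I_d, (m <= i)%N -> f x 0 i = 0)].

(** * Curved exponential families *)

Definition natural_image (R : realType) (X : finType) (d : nat)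
    (F : exp_family R X d) (M : set (X -> R)) : set 'rV[R]_d :=
  [set natural F t | t in [set t | param_space F t /\ M (density F t)]].

Definition curved_exponential_family (R : realType) (X : finType)
    (M : set (X -> R)) : Prop :=
  exists (d : nat) (F : exp_family R X d),
    [/\ regular F,
        M `<=` [set density F t | t in param_space F],
        natural_image F M `<=` natural_space F &
        smooth_submanifold (natural_image F M)].

(* Main.v *)
From mathcomp Require Import all_boot all_order all_algebra.
From mathcomp Require Import all_classical all_reals all_analysis.
From mathcomp Require Import ring.
Require Import Defs.

Set Implicit Arguments.
Unset Strict Implicit.
Unset Printing Implicit Defensive.

Import Order.TTheory GRing.Theory Num.Theory.
Import numFieldNormedType.Exports.

Local Open Scope classical_set_scope.
Local Open Scope ring_scope.

(** The ambient regular family consists of all strictly positive distributions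
    on the root-to-leaf paths.  It is presented as a log-linear model whose
    statistic records, for every inner vertex v and every j > 0, whether the
    path uses the j-th edge of v ([edge_counts]); the first edge of each vertex,
    which has index 0, serves as reference, so that the natural parameter eta
    ranges over the whole of R^d, where d is the number of these pairs (v, j).

    A positive distribution is also described by its conditional probabilities
    theta at the inner vertices, that is, by their log-odds
    lambda_vj = ln theta_vj - ln theta_v0, which range freely over R^d as well.
    In these coordinates the stage constraints are linear: theta_v = theta_s
    exactly when lambda_vj = lambda_sj for all j.  It remains to see that the
    passage between eta and lambda is a diffeomorphism of R^d and to turn the
    linear subspace into a coordinate slice.

    Both directions come from one telescoping identity
    ([weight_telescope]): if every edge from v to w carries the label F w / F v,
    the product of the labels along the path from the root to u is
    F u / F root.
    - For F u the mass of the set of paths through u it says that a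
      distribution is the path distribution of its conditional probabilities
      ([path_prob_cond]); conversely the conditional probabilities of a path
      distribution are its labels, since the mass below u equals the product
      of the labels leading to u ([mass_path_prob]).  Hence
      lambda_vj = ln (mass of the j-th child) - ln (mass of the first child).
    - For F u the probability of the path that goes to u and then always takes
      the first edge ([first_leaf]) it produces labels equal to 1 on all first
      edges, and thereby the natural parameter
      eta_vj = ln F (j-th child of v) - ln F v.
    The two maps are mutually inverse ([to_log_oddsK], [of_log_oddsK]), and
    smooth because they are built from coordinates by sums, products, exp, and
    ln and inverse of positive functions, a class closed under partial
    derivatives ([elementary_derive]).

    Finally a shear that subtracts from each lambda_vj the coordinate
    lambda_rj of the chosen representative r of the stage of v, with the
    coordinates of representatives listed first, carries the staged
    subspace to the set where the last coordinates vanish ([shear_slice]).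
    The composite is a single global slice chart. *)

(** * Elementary functions are smooth *)

(** A syntactic class is used rather than closure properties of [Ck]: it is
    stable under differentiation, so smoothness of all orders follows from
    continuity and differentiability alone. *)
Inductive elementary (R : realType) (d : nat) : ('rV[R]_d -> R) -> Prop :=
| elementary_cst c : elementary (fun=> c)
| elementary_coord i : elementary (fun x => x 0 i)
| elementaryD f g : elementary f -> elementary g ->
    elementary (fun x => f x + g x)
| elementaryM f g : elementary f -> elementary g ->
    elementary (fun x => f x * g x)
| elementary_expR f : elementary f -> elementary (fun x => expR (f x))
| elementary_ln f : (forall x, 0 < f x) -> elementary f ->
    elementary (fun x => ln (f x))
| elementaryV f : (forall x, 0 < f x) -> elementary f ->
    elementary (fun x => (f x)^-1).

Section Elementary.
Variables (R : realType) (d : nat).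
Implicit Type f : 'rV[R]_d -> R.

Lemma elementary_ext f g : f =1 g -> elementary f -> elementary g.
Proof. by move=> /funext ->. Qed.

Lemma elementaryB f g : elementary f -> elementary g ->
  elementary (fun x => f x - g x).
Proof.
move=> ef eg; apply: (@elementary_ext (fun x => f x + (-1) * g x)).
  by move=> x; rewrite mulN1r.
exact: elementaryD ef (elementaryM (elementary_cst _ _) eg).
Qed.

Lemma elementary_sum (I : Type) (r : seq I) (P : pred I)
    (F : I -> 'rV[R]_d -> R) :
  (forall i, P i -> elementary (F i)) ->
  elementary (fun x => \sum_(i <- r | P i) F i x).
Proof.
move=> eF; elim: r => [|i r IHr].
  by apply: elementary_ext (elementary_cst _ 0) => x; rewrite big_nil.
case Pi: (P i).
  apply: elementary_ext (elementaryD (eF i Pi) IHr) => x.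
  by rewrite big_cons Pi.
by apply: elementary_ext IHr => x; rewrite big_cons Pi.
Qed.

Lemma elementary_prod (I : Type) (r : seq I) (P : pred I)
    (F : I -> 'rV[R]_d -> R) :
  (forall i, P i -> elementary (F i)) ->
  elementary (fun x => \prod_(i <- r | P i) F i x).
Proof.
move=> eF; elim: r => [|i r IHr].
  by apply: elementary_ext (elementary_cst _ 1) => x; rewrite big_nil.
case Pi: (P i).
  apply: elementary_ext (elementaryM (eF i Pi) IHr) => x.
  by rewrite big_cons Pi.
by apply: elementary_ext IHr => x; rewrite big_cons Pi.
Qed.

Lemma elementaryX f n : elementary f -> elementary (fun x => f x ^+ n).
Proof.
move=> ef; elim: n => [|n IHn].
  by apply: elementary_ext (elementary_cst _ 1) => x; rewrite expr0.
by apply: elementary_ext (elementaryM ef IHn) => x; rewrite exprS.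
Qed.

Lemma elementary_comp e f (h : 'rV[R]_e -> 'rV[R]_d) :
  elementary f -> (forall i, elementary (fun x => h x 0 i)) ->
  elementary (fun x => f (h x)).
Proof.
move=> ef eh.
elim: ef => [c|i|f1 g1 _ ? _ ?|f1 g1 _ ? _ ?|f1 _ ?|f1 f0 _ ?|f1 f0 _ ?].
- exact: elementary_cst.
- exact: eh.
- exact: elementaryD.
- exact: elementaryM.
- exact: elementary_expR.
- exact: (elementary_ln (fun x => f0 (h x))).
- exact: (elementaryV (fun x => f0 (h x))).
Qed.

Lemma differentiable_ln (y : R) : 0 < y -> differentiable (@ln R) y.
Proof.
by move=> y0; apply/derivable1_diffP; apply: ex_derive; exact: is_derive1_ln.
Qed.

Lemma differentiable_expR (y : R) : differentiable (@expR R) y.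
Proof. by apply/derivable1_diffP; exact: derivable_expR. Qed.

Lemma elementary_differentiable f x : elementary f -> differentiable f x.
Proof.
elim=> [c|i|f1 g1 _ ? _ ?|f1 g1 _ ? _ ?|f1 _ ?|f1 f0 _ ?|f1 f0 _ ?].
- exact: differentiable_cst.
- exact: differentiable_coord.
- exact: differentiableD.
- exact: differentiableM.
- exact: differentiable_comp (differentiable_expR _).
- exact: differentiable_comp (differentiable_ln _).
- by apply: differentiableV => //; rewrite gt_eqF.
Qed.

Lemma derive_coord (x v : 'rV[R]_d) i :
  'D_v (fun y : 'rV[R]_d => y 0 i) x = v 0 i.
Proof.
have := derive_mx (@derivable_id _ _ x v).
rewrite derive_id => /matrixP/(_ 0 i).
by rewrite mxE => <-.
Qed.

Lemma derive_chain (g : R -> R) f (x v : 'rV[R]_d) :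
  differentiable f x -> differentiable g (f x) ->
  'D_v (fun y => g (f y)) x = 'D_v f x * 'D_1 g (f x).
Proof.
move=> df dg; rewrite (deriveE _ (differentiable_comp df dg)) diff_comp //=.
by rewrite deriv1E ?derive1E ?deriveE //; exact/derivable1_diffP.
Qed.

(** The usual rules of differentiation never leave the class. *)
Lemma elementary_derive f v : elementary f -> elementary (fun x => 'D_v f x).
Proof.
have dE := elementary_differentiable.
have DE h x : elementary h -> derivable h x v.
  by move=> eh; apply: diff_derivable; exact: dE.
elim=> [c|i|f1 g1 ef IHf eg IHg|f1 g1 ef IHf eg IHg|f1 ef IHf
       |f1 f0 ef IHf|f1 f0 ef IHf].
- by apply: elementary_ext (elementary_cst _ 0) => x; rewrite derive_cst.
- apply: elementary_ext (elementary_cst _ (v 0 i)) => x.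
  by rewrite derive_coord.
- apply: elementary_ext (elementaryD IHf IHg) => x.
  by rewrite -deriveD; try exact: DE.
- apply: elementary_ext (elementaryD (elementaryM ef IHg) (elementaryM eg IHf)).
  by move=> x; rewrite -[LHS]deriveM; try exact: DE.
- apply: elementary_ext (elementaryM IHf (elementary_expR ef)) => x.
  rewrite derive_chain; [|exact: dE|exact: differentiable_expR].
  by have [_ ->] := is_derive_expR (f1 x).
- apply: elementary_ext (elementaryM IHf (elementaryV f0 ef)) => x.
  rewrite derive_chain; [|exact: dE|exact: differentiable_ln].
  by have [_ ->] := is_derive1_ln (f0 x).
- apply: elementary_ext (elementaryM (elementaryM (elementary_cst _ (-1))
    (elementaryX 2 (elementaryV f0 ef))) IHf) => x.
  by rewrite deriveV ?gt_eqF //; [rewrite mulN1r exprVn|exact: DE].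
Qed.

Lemma elementary_Ck n f : elementary f -> Ck n setT f.
Proof.
have cts (h : 'rV[R]_d -> R) :
    elementary h -> forall x, setT x -> {for x, continuous h}.
  by move=> eh x _; apply/differentiable_continuous/elementary_differentiable.
elim: n f => [|n IHn] f ef /=; split; try exact: cts; first by [].
move=> i; split; last exact/IHn/elementary_derive.
by move=> x _; apply/diff_derivable/elementary_differentiable.
Qed.

Lemma elementary_smooth e (h : 'rV[R]_d -> 'rV[R]_e) :
  (forall i, elementary (fun x => h x 0 i)) -> smooth_on setT h.
Proof. by move=> eh i n; exact: elementary_Ck. Qed.

End Elementary.

Section GlobalDiffeo.
Variables (R : realType) (d : nat) (f g : 'rV[R]_d -> 'rV[R]_d).

Lemma elementary_diffeo : cancel f g -> cancel g f ->
  (forall i, elementary (fun x => f x 0 i)) ->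
  (forall i, elementary (fun x => g x 0 i)) -> diffeo setT setT f g.
Proof.
by move=> fK gK ef eg; split=> //; [split; exact: openT|
  exact: elementary_smooth|exact: elementary_smooth].
Qed.

End GlobalDiffeo.

(** * Routes in a rooted tree *)

Section Tree.
Variable T : rooted_tree.
Implicit Types (u w : T) (v : inner T) (x : leaf_path T).

Definition child v (j : nat) : T := nth (root T) (kids (sval v)) j.

(** The unique path from the root to [u], without its starting point. *)
Definition route u : seq T := sval (cid (root_path u)).

Lemma route_path u : path (@edge T) (root T) (route u).
Proof. by rewrite /route; case: cid => p [[]]. Qed.

Lemma last_route u : last (root T) (route u) = u.
Proof. by rewrite /route; case: cid => p [[]]. Qed.

Lemma route_last p : path (@edge T) (root T) p -> route (last (root T) p) = p.
Proof. by move=> pp; rewrite /route; case: cid => q [] _ /=; apply. Qed.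

Lemma route_root : route (root T) = [::].
Proof. exact: (@route_last [::]). Qed.

Lemma route_inj : injective route.
Proof. by move=> u w uw; rewrite -(last_route u) uw last_route. Qed.

Lemma route_edge u w : w \in kids u -> route w = rcons (route u) w.
Proof.
move=> uw; rewrite -[in LHS](last_rcons (root T) (route u) w) route_last //.
by rewrite rcons_path route_path last_route.
Qed.

(** A route with a repeated vertex could be shortened to a second path with
    the same endpoint, contradicting uniqueness. *)
Lemma route_uniq u : uniq (root T :: route u).
Proof.
have := last_route u; case/shortenP: (route_path u) => p pp Up _ <-.
by rewrite route_last.
Qed.

Lemma size_route u : (size (route u) < #|T|)%N.
Proof.
have := max_card (mem (root T :: route u)).
by rewrite (card_uniqP (route_uniq u)).
Qed.

Lemma route_prefix u w :
  u \in root T :: route w -> exists p, route w = route u ++ p.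
Proof.
move=> /splitPl; case E: _ / => [p q lpu]; exists q; congr (_ ++ _).
rewrite -lpu route_last //.
by have := route_path w; rewrite E cat_path => /andP[].
Qed.

Definition Inner u (ku : kids u != [::]) : inner T := exist _ u ku.

Lemma kappa_gt1 v : (1 < kappa v)%N.
Proof.
case: v => v kv; rewrite /kappa /=; have := kids_neq1 v; move: kv.
by case: (kids v) => [|a [|b s]].
Qed.

Lemma kappa_gt0 v : (0 < kappa v)%N.
Proof. exact: ltnW (kappa_gt1 v). Qed.

Definition edge0 v : 'I_(kappa v) := Ordinal (kappa_gt0 v).

Lemma child_kids v j : (j < kappa v)%N -> child v j \in kids (sval v).
Proof. exact: mem_nth. Qed.

Lemma childP v w :
  w \in kids (sval v) -> exists j : 'I_(kappa v), w = child v j.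
Proof.
move=> vw; have jv : (index w (kids (sval v)) < kappa v)%N by rewrite index_mem.
by exists (Ordinal jv); rewrite /child nth_index.
Qed.

Lemma route_child v j : (j < kappa v)%N ->
  route (child v j) = rcons (route (sval v)) (child v j).
Proof. by move=> jv; apply: route_edge; exact: child_kids. Qed.

(** A vertex determines its parent, the penultimate vertex of its route, and
    its position among the children of this parent. *)
Lemma child_inj v v' j j' : (j < kappa v)%N -> (j' < kappa v')%N ->
  child v j = child v' j' -> (v, j) = (v', j').
Proof.
move=> jv jv' cc; have := route_child jv.
rewrite cc route_child // => /rcons_inj[] /route_inj/val_inj vv'.
move: jv cc; rewrite -vv' => jv /eqP.
by rewrite nth_uniq ?kids_uniq // => /eqP ->.
Qed.

Lemma child_eq v v' j j' : (j < kappa v)%N -> (j' < kappa v')%N ->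
  (child v j == child v' j') = ((v, j) == (v', j')).
Proof.
move=> jv jv'; apply/eqP/eqP; first exact: child_inj.
by move=> [-> ->].
Qed.

Lemma mem_route_child v v' j j' : (j < kappa v)%N -> (j' < kappa v')%N ->
  (child v j \in route (child v' j') : nat) =
  ((child v j \in route (sval v')) + ((v, j) == (v', j')))%N.
Proof.
move=> jv jv'; rewrite (route_child jv') mem_rcons inE child_eq //.
have [[-> ->]|] := eqVneq; last by rewrite addn0.
have := route_uniq (child v' j'); rewrite route_child // -rcons_cons rcons_uniq.
by rewrite inE negb_or => /andP[/andP[_ /negPf ->]].
Qed.

Lemma root_ind (P : T -> Prop) :
  P (root T) -> (forall v (j : 'I_(kappa v)), P (sval v) -> P (child v j)) ->
  forall u, P u.
Proof.
move=> P0 PS u; rewrite -(last_route u).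
elim/last_ind: (route u) (route_path u) => [//|p w IHp].
rewrite rcons_path last_rcons => /andP[/IHp Pp pw].
have kp : kids (last (root T) p) != [::].
  by move: pw; rewrite /edge; case: (kids _).
by have [j ->] := @childP (Inner kp) w pw; exact: PS.
Qed.

(** Induction from the leaves up, well founded because depth is bounded by the
    number of vertices. *)
Lemma leaf_ind (P : T -> Prop) :
  (forall u, kids u = [::] -> P u) ->
  (forall v, (forall j : 'I_(kappa v), P (child v j)) -> P (sval v)) ->
  forall u, P u.
Proof.
move=> P0 PS u; have [n] := ubnP (#|T| - size (route u)).
elim: n u => [//|n IHn] u un; have [/P0 //|ku] := eqVneq (kids u) [::].
apply: (PS (Inner ku)) => j; apply: IHn.
rewrite route_child // size_rcons /=; have := size_route u.
rewrite -subn_gt0 => u0; rewrite ltnS in un.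
by rewrite subnS prednK.
Qed.

Definition goal x : T := last (root T) (sval x).

Lemma route_goal x : route (goal x) = sval x.
Proof. by rewrite route_last //; case: x => x /= /andP[]. Qed.

Lemma goal_leaf x : kids (goal x) = [::].
Proof. by rewrite /goal; case: x => x /= /andP[_ /eqP]. Qed.

Lemma goal_inj : injective goal.
Proof.
by move=> x y xy; do 2!apply: val_inj; rewrite /= -!route_goal xy.
Qed.

Lemma leaf_goal u : kids u = [::] -> exists x, goal x = u.
Proof.
move=> ku; have su : (size (route u) <= #|T|)%N by exact: ltnW (size_route u).
have ux : path (@edge T) (root T) (Bseq su) &&
    (kids (last (root T) (Bseq su)) == [::]).
  by rewrite /= route_path last_route ku eqxx.
by exists (exist _ (Bseq su) ux : leaf_path T); rewrite /goal /= last_route.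
Qed.

Lemma mem_zip_path u w (p : seq T) (a : T) : 
  reflect (exists p1 p2, p = p1 ++ w :: p2 /\ last a p1 = u)
    ((u, w) \in zip (a :: p) p).
Proof.
apply: (iffP idP); last first.
  move=> [p1 [p2 [-> <-]]]; elim: p1 a => [|b p1 IHp] a /=.
    by rewrite inE eqxx.
  by rewrite inE IHp orbT.
elim: p a => [//|b p IHp] a; rewrite /= inE => /orP[/eqP[-> ->]|].
  by exists [::], p.
by move=> /IHp[p1 [p2 [-> <-]]]; exists (b :: p1), p2.
Qed.

Lemma alphaE v (j : 'I_(kappa v)) x :
  alpha j x = (child v j \in route (goal x)) :> nat.
Proof.
rewrite /alpha route_goal; congr nat_of_bool; apply/mem_zip_path/idP.
  by move=> [p1 [p2 [-> _]]]; rewrite mem_cat inE eqxx orbT.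
move=> cx; have : child v j \in root T :: route (goal x).
  by rewrite inE route_goal cx orbT.
move=> /route_prefix[p]; rewrite route_goal route_child // => ->.
by exists (route (sval v)), p; rewrite last_route cat_rcons.
Qed.

(** * Path weights and subtree masses *)

Variable R : realType.
Implicit Types (theta : labelling R T) (p : leaf_path T -> R).

(** The product of the labels on the path from the root to [u], written in the
    shape of [path_prob] but making sense at inner vertices too. *)
Definition weight theta u : R :=
  \prod_v \prod_(j < kappa v) theta v j ^+ (child v j \in route u).

Lemma path_prob_weight theta x : path_prob theta x = weight theta (goal x).
Proof. by do 2!apply: eq_bigr => ? _; rewrite alphaE. Qed.

Lemma weight_root theta : weight theta (root T) = 1.
Proof.
by rewrite /weight; do 2!rewrite big1 // => ? _; rewrite route_root expr0.
Qed.

Lemma weight_child theta v (j : 'I_(kappa v)) :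
  weight theta (child v j) = weight theta (sval v) * theta v j.
Proof.
rewrite /weight.
under eq_bigr do under eq_bigr do rewrite mem_route_child // exprD.
under eq_bigr do rewrite big_split.
rewrite big_split; congr (_ * _).
rewrite (bigD1 v) //= [X in _ * X]big1 ?mulr1 => [|v' /negPf v'v]; last first.
  by rewrite big1 // => k _; rewrite xpair_eqE v'v expr0.
rewrite (bigD1 j) //= eqxx expr1 big1 ?mulr1 // => k kj.
by rewrite xpair_eqE eqxx /= (negPf (kj : k != j :> nat)) expr0.
Qed.

Lemma weight_gt0 theta u : (forall v j, 0 < theta v j) -> 0 < weight theta u.
Proof. by move=> theta0; do 2!apply: prodr_gt0 => ? _; exact: exprn_gt0. Qed.

(** Each step of the path from the root to [u] contributes the quotient of two
    consecutive values of [F]. *)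
Lemma weight_telescope (F : T -> R) u : (forall w, F w != 0) ->
  weight (fun v j => F (child v j) / F (sval v)) u = F u / F (root T).
Proof.
move=> F0; elim/root_ind: u => [|v j IHv]; first by rewrite weight_root divff.
by rewrite weight_child IHv mulrC mulrA divfK.
Qed.

Definition mass p u : R :=
  \sum_(x | u \in root T :: route (goal x)) p x.

Lemma mass_root p : mass p (root T) = \sum_x p x.
Proof. by apply: eq_bigl => x; rewrite mem_head. Qed.

Lemma mass_goal p x : mass p (goal x) = p x.
Proof.
rewrite /mass (big_pred1 x) // => y; apply/idP/eqP => [|->]; last first.
  by rewrite -[X in X \in _]last_route mem_last.
move=> /route_prefix[q yxq]; apply: goal_inj; apply: route_inj; rewrite yxq.
case: q yxq => [|w q yxq]; first by rewrite cats0.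
have := route_path (goal y); rewrite yxq cat_path /= /edge last_route goal_leaf.
by rewrite andbF.
Qed.

(** A path through an inner vertex goes on through exactly one of its
    children. *)
Lemma mass_child p v : mass p (sval v) = \sum_(j < kappa v) mass p (child v j).
Proof.
rewrite /mass [LHS]big_mkcond; under [RHS]eq_bigr do rewrite big_mkcond.
rewrite exchange_big; apply: eq_bigr => x _; case: ifPn => [vx|vNx]; last first.
  rewrite big1 // => j _; case: ifP => // /route_prefix[q xq].
  move: vNx; rewrite xq route_child // cat_rcons -cat_cons mem_cat.
  by rewrite -[X in X \in _](last_route (sval v)) mem_last.
have [[|w q] xq] := route_prefix vx.
  have := goal_leaf x; rewrite -(last_route (goal x)) xq cats0 last_route => vl.
  by case: (v) vl => /= u uk /eqP; rewrite (negPf uk).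
have := route_path (goal x); rewrite xq cat_path last_route => /and3P[_ vw _].
have [j wj] := childP vw; rewrite (bigD1 j) //= big1 ?addr0.
  by rewrite wj inE mem_cat mem_head !orbT.
move=> k kj; case: ifP => // /[!inE]/predU1P[k0|].
  by have := route_child (ltn_ord k); rewrite k0 route_root; case: (route _).
rewrite -xq => kx.
have /route_prefix[q'] : child v k \in root T :: route (goal x).
  by rewrite inE kx orbT.
rewrite xq route_child // cat_rcons => /(congr1 (drop (size (route (sval v))))).
rewrite !drop_size_cat // => -[+ _]; rewrite wj => /child_inj.
by move=> /(_ (ltn_ord _) (ltn_ord _)) [] jk; rewrite (val_inj jk) eqxx in kj.
Qed.

Lemma mass_gt0 p u : (forall x, 0 < p x) -> 0 < mass p u.
Proof.
move=> p0; elim/leaf_ind: u => [u /leaf_goal[x <-]|v IHv].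
  by rewrite mass_goal.
rewrite mass_child (bigD1 (edge0 v)) //= ltr_pwDl ?(IHv (edge0 v)) //.
by apply: sumr_ge0 => j _; exact: ltW.
Qed.

Lemma massZ c p u : mass (fun x => c * p x) u = c * mass p u.
Proof. by rewrite mulr_sumr. Qed.

(** Below a vertex the labels of a probability tree sum up to total mass 1, so
    only the labels leading to [u] remain. *)
Lemma mass_path_prob theta u : (forall v, \sum_(j < kappa v) theta v j = 1) ->
  mass (path_prob theta) u = weight theta u.
Proof.
move=> theta1; elim/leaf_ind: u => [u /leaf_goal[x <-]|v IHv].
  by rewrite mass_goal path_prob_weight.
rewrite mass_child (eq_bigr (fun j => weight theta (sval v) * theta v j)).
  by rewrite -mulr_sumr theta1 mulr1.
by move=> j _; rewrite IHv weight_child.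
Qed.

Definition cond_prob p : labelling R T :=
  fun v j => mass p (child v j) / mass p (sval v).

(** The conditional probabilities are quotients of masses, and telescope. *)
Lemma path_prob_cond p x : (forall y, 0 < p y) ->
  path_prob (cond_prob p) x = p x / \sum_y p y.
Proof.
move=> p0; rewrite path_prob_weight weight_telescope; last first.
  by move=> u; rewrite gt_eqF ?mass_gt0.
by rewrite mass_goal mass_root.
Qed.

(** The upper bound in the open simplex is automatic, as there are at least two
    edges at each inner vertex. *)
Lemma tree_params_pos theta : (forall v j, 0 < theta v j) ->
  (forall v, \sum_(j < kappa v) theta v j = 1) -> tree_params theta.
Proof.
move=> theta0 theta1 v; split=> // j; rewrite theta0 /=.
pose k : 'I_(kappa v) :=
  if j == edge0 v then Ordinal (kappa_gt1 v) else edge0 v.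
have kj : k != j by rewrite /k; case: (eqVneq j) => [->|] //; rewrite eq_sym.
rewrite -(theta1 v) (bigD1 j) //= ltrDl (bigD1 k) //= ltr_pwDl //.
by apply: sumr_ge0 => i _; exact: ltW.
Qed.

(** * The leftmost leaf below a vertex *)

(** Taking the first child as many times as there are vertices leads to a leaf,
    where the iteration is stationary since [head] then returns its default. *)
Definition first_leaf u : T := iter #|T| (fun w => head w (kids w)) u.

Lemma first_leaf_leaf u : kids (first_leaf u) = [::].
Proof.
suff iterP n : kids (iter n (fun w => head w (kids w)) u) = [::] \/
    (n <= size (route (iter n (fun w => head w (kids w)) u)))%N.
  by have [//|] := iterP #|T|; rewrite leqNgt size_route.
elim: n => [|n IHn]; first by right.
rewrite iterS; set w := iter n _ u in IHn *.
case: IHn => [kw|]; first by left; rewrite kw.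
case kw: (kids w) => [|a s]; first by left; rewrite kw.
by right; rewrite /= (@route_edge w a) ?size_rcons // kw mem_head.
Qed.

Lemma first_leaf_id u : kids u = [::] -> first_leaf u = u.
Proof.
by move=> ku; rewrite /first_leaf; elim: #|T| => //= n ->; rewrite ku.
Qed.

Lemma first_leaf_child v : first_leaf (child v 0) = first_leaf (sval v).
Proof.
have -> : child v 0 = (fun w => head w (kids w)) (sval v).
  by have := kappa_gt0 v; rewrite /child /kappa; case: (kids _).
rewrite /first_leaf -iterSr iterS.
by have := first_leaf_leaf (sval v); rewrite /first_leaf => ->.
Qed.

Lemma weight_first_leaf theta u : (forall v, theta v (edge0 v) = 1) ->
  weight theta (first_leaf u) = weight theta u.
Proof.
move=> theta1; elim/leaf_ind: u => [u /first_leaf_id -> //|v IHv].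
by rewrite -first_leaf_child (IHv (edge0 v)) weight_child theta1 mulr1.
Qed.

End Tree.

(** * Log-linear families *)

Section LogLinear.
Variables (R : realType) (X : finType) (x0 : X) (d : nat) (S : X -> 'rV[R]_d).
Implicit Types (eta : 'rV[R]_d) (x : X).

Definition partition_function eta : R := \sum_x expR (dotp eta (S x)).

Lemma partition_function_gt0 eta : 0 < partition_function eta.
Proof.
rewrite /partition_function (bigD1 x0) //= ltr_pwDl ?expR_gt0 //.
by apply: sumr_ge0 => x _; exact: expR_ge0.
Qed.

Definition log_linear_density eta x : R :=
  expR (dotp eta (S x) - ln (partition_function eta)).

Lemma log_linear_densityE eta x :
  log_linear_density eta x = expR (dotp eta (S x)) / partition_function eta.
Proof.
by rewrite /log_linear_density expRB lnK // posrE partition_function_gt0.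
Qed.

Lemma log_linear_density_ge0 eta x : setT eta -> 0 <= log_linear_density eta x.
Proof. by move=> _; exact: expR_ge0. Qed.

Lemma log_linear_density_sum1 eta :
  setT eta -> \sum_x log_linear_density eta x = 1.
Proof.
move=> _; under eq_bigr do rewrite log_linear_densityE.
by rewrite -mulr_suml divff // gt_eqF ?partition_function_gt0.
Qed.

(** The density is constant on the fibres of [S], so the conditional
    distribution given [S] is uniform on each fibre. *)
Lemma log_linear_sufficient : sufficient setT log_linear_density S.
Proof.
exists (fun x => (#|[pred y | S y == S x]|%:R)^-1) => eta x _.
rewrite (eq_bigr (fun=> log_linear_density eta x)) => [|y /eqP yx]; last first.
  by rewrite /log_linear_density yx.
rewrite sumr_const -[X in _ = _ * X]mulr_natl mulKf // pnatr_eq0 -lt0n.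
by apply/card_gt0P; exists x; rewrite inE.
Qed.

(** Suppose that a sufficient statistic does not distinguish [x] from [y].  Then
    the ratio of their densities is the same for all parameters, and it is 1 at
    parameter 0, where the density is uniform; testing on the unit vectors
    shows that [S] does not distinguish [x] from [y] either. *)
Lemma log_linear_minimal : minimal_sufficient setT log_linear_density S.
Proof.
split=> [|Z S' [k kE]]; first exact: log_linear_sufficient.
have S'S x y : S' x = S' y -> S x = S y.
  move=> xy.
  have kxy : k x = k y.
    have := kE 0 x I; have := kE 0 y I; rewrite xy.
    set c := \sum_(z | _) _ => dy dx.
    have dotp0 u : dotp 0 u = 0 :> R.
      by rewrite /dotp big1 // => i _; rewrite mxE mul0r.
    have c0 : c != 0.
      apply/eqP => c0; move: dy; rewrite c0 mulr0 /log_linear_density => /eqP.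
      by rewrite gt_eqF ?expR_gt0.
    by apply: (mulIf c0); rewrite -dx -dy /log_linear_density !dotp0.
  have dxy eta : log_linear_density eta x = log_linear_density eta y.
    by rewrite [LHS](kE eta x I) [RHS](kE eta y I) kxy xy.
  apply/rowP => i; have := dxy (delta_mx 0 i) => /expR_inj/addIr.
  have dotp_delta u : dotp (delta_mx 0 i) u = u 0 i :> R.
    rewrite /dotp (bigD1 i) //= mxE !eqxx mul1r big1 ?addr0 // => l li.
    by rewrite mxE (negPf li) andbF mul0r.
  by rewrite !dotp_delta.
exists (fun z => if [pick x | S' x == z] is Some x then S x else 0).
move=> eta x _ _; case: pickP => [y /eqP yx|/(_ x)]; last by rewrite eqxx.
exact/esym/S'S.
Qed.

Definition log_linear_family : exp_family R X d :=
  ExpFamily (base := fun=> 1) (natural := id)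
    (cumulant := fun eta => ln (partition_function eta))
    log_linear_density_ge0 log_linear_density_sum1
    (fun eta x _ => esym (mul1r (log_linear_density eta x)))
    log_linear_minimal.

Lemma log_linear_natural_space : natural_space log_linear_family = setT.
Proof.
apply/seteqP; split=> // eta _; exists eta => //; split=> //.
by rewrite sumEFin ltry.
Qed.

Lemma log_linear_regular : regular log_linear_family.
Proof.
by rewrite /regular log_linear_natural_space; split; [exists 0|exact: openT].
Qed.

End LogLinear.

(** * Natural parameters and conditional log-odds *)

Section Coordinates.
(* [e] enumerates the edges other than the first of each inner vertex; it is
   kept abstract because its order matters for the slice chart only. *)
Variables (R : realType) (T : rooted_tree) (d : nat).
Variable e : 'I_d -> inner T * nat.
Hypothesis e_inj : injective e.
Hypothesis e_edge : forall v j, (0 < j < kappa v)%N <-> exists i, e i = (v, j).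
Implicit Types (v : inner T) (x : leaf_path T) (eta lambda : 'rV[R]_d).

(** The coordinate of [eta] attached to the [j]-th edge of [v], extended by 0 to
    the reference edges: writing it as a sum avoids inverting [e] and makes it
    visibly linear. *)
Definition coord eta v j : R := \sum_i eta 0 i *+ (e i == (v, j)).

Definition vec (a : inner T -> nat -> R) : 'rV[R]_d := \row_i a (e i).1 (e i).2.

Lemma edge_index_bounds i : (0 < (e i).2 < kappa (e i).1)%N.
Proof. by apply/e_edge; exists i; case: (e i). Qed.

Lemma coord_e eta i : coord eta (e i).1 (e i).2 = eta 0 i.
Proof.
rewrite /coord (bigD1 i) //= -surjective_pairing eqxx mulr1n.
rewrite big1 ?addr0 // => k ki.
by rewrite (inj_eq e_inj) (negPf ki).
Qed.

Lemma coord0 eta v : coord eta v 0 = 0.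
Proof.
rewrite /coord big1 // => i _; case: eqP => // ei.
by have := edge_index_bounds i; rewrite ei.
Qed.

Lemma coord_vec a v j : a v 0%N = 0 -> (j < kappa v)%N ->
  coord (vec a) v j = a v j.
Proof.
case: j => [|j] a0 jv; first by rewrite coord0 a0.
have [i ei] : exists i, e i = (v, j.+1) by apply/e_edge.
by have := coord_e (vec a) i; rewrite mxE ei.
Qed.

Lemma elementary_coordE v j : elementary (fun eta => coord eta v j).
Proof.
apply: elementary_sum => i _; case: eqP => _.
  exact: elementary_coord.
exact: elementary_cst.
Qed.

Definition exp_label eta : labelling R T := fun v j => expR (coord eta v j).

Definition softmax lambda : labelling R T :=
  fun v j =>
    expR (coord lambda v j) / \sum_(k < kappa v) expR (coord lambda v k).

Definition edge_counts x : 'rV[R]_d :=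
  \row_i (child (e i).1 (e i).2 \in route (goal x))%:R.

(** The unnormalised log-linear weights are themselves products of edge labels,
    with label 1 on the first edges. *)
Lemma expR_dotp_edge_counts eta x :
  expR (dotp eta (edge_counts x)) = path_prob (exp_label eta) x.
Proof.
rewrite path_prob_weight /dotp.
under eq_bigr do rewrite mxE.
elim/root_ind: (goal x) => [|v j IHv].
  by rewrite weight_root big1 ?expR0 // => i _; rewrite route_root mulr0.
rewrite weight_child -IHv -expRD -big_split; congr expR; apply: eq_bigr => i _.
have /andP[_ eiv] := edge_index_bounds i.
rewrite mem_route_child // natrD mulrDr -surjective_pairing.
by rewrite -[X in _ = _ + X]mulr_natr.
Qed.

Lemma exp_label_gt0 eta v (j : 'I_(kappa v)) : 0 < exp_label eta j.
Proof. exact: expR_gt0. Qed.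

Lemma softmax_sum_gt0 lambda v : 0 < \sum_(k < kappa v) expR (coord lambda v k).
Proof.
rewrite (bigD1 (edge0 v)) //= ltr_pwDl ?expR_gt0 //.
by apply: sumr_ge0 => k _; exact: expR_ge0.
Qed.

Lemma softmax_gt0 lambda v (j : 'I_(kappa v)) : 0 < softmax lambda j.
Proof. by rewrite divr_gt0 ?expR_gt0 // softmax_sum_gt0. Qed.

Lemma softmax_params lambda : tree_params (softmax lambda).
Proof.
apply: tree_params_pos => [v j|v]; first exact: softmax_gt0.
by rewrite -mulr_suml divff // gt_eqF ?softmax_sum_gt0.
Qed.

Lemma coord_softmax lambda v (j : 'I_(kappa v)) :
  coord lambda v j = ln (softmax lambda j) - ln (softmax lambda (edge0 v)).
Proof.
rewrite /softmax !ln_div ?posrE ?expR_gt0 ?softmax_sum_gt0 //.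
by rewrite !expRK coord0; ring.
Qed.

Lemma path_prob_gt0 (theta : labelling R T) x :
  (forall v j, 0 < theta v j) -> 0 < path_prob theta x.
Proof. by rewrite path_prob_weight; exact: weight_gt0. Qed.

Definition log_odds (p : leaf_path T -> R) v j : R :=
  ln (mass p (child v j)) - ln (mass p (child v 0)).

Lemma log_odds0 p v : log_odds p v 0 = 0.
Proof. exact: subrr. Qed.

(** The mass of the first child cancels against the normalising sum. *)
Lemma softmax_log_odds p : (forall x, 0 < p x) ->
  softmax (vec (log_odds p)) = cond_prob p.
Proof.
move=> p0; apply: functional_extensionality_dep => v; apply: funext => j.
have E k : (k < kappa v)%N -> expR (coord (vec (log_odds p)) v k) =
    mass p (child v k) / mass p (child v 0).
  move=> kv; rewrite coord_vec ?log_odds0 // expRB !lnK // posrE mass_gt0 //.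
rewrite /softmax /cond_prob mass_child E //.
rewrite (eq_bigr (fun k : 'I__ => mass p (child v k) / mass p (child v 0))).
  by rewrite -mulr_suml invf_div mulrA divfK // gt_eqF ?mass_gt0.
by move=> k _; rewrite E.
Qed.

(** The masses of consecutive vertices are products of labels that differ in a
    single factor. *)
Lemma cond_prob_path_prob (theta : labelling R T) :
  tree_params theta -> cond_prob (path_prob theta) = theta.
Proof.
move=> thetaP; have theta0 v j : 0 < theta v j.
  by have [_ /(_ j)/andP[]] := thetaP v.
apply: functional_extensionality_dep => v; apply: funext => j.
rewrite /cond_prob !mass_path_prob; try by move=> w; have [] := thetaP w.
by rewrite weight_child mulrC mulKf // gt_eqF ?weight_gt0.
Qed.

Lemma log_odds_path_prob (c : R) (theta : labelling R T) v (j : 'I_(kappa v)) :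
  0 < c -> tree_params theta ->
  log_odds (fun x => c * path_prob theta x) v j =
  ln (theta v j) - ln (theta v (edge0 v)).
Proof.
move=> c0 thetaP; have theta0 w k : 0 < theta w k.
  by have [_ /(_ k)/andP[]] := thetaP w.
rewrite /log_odds !massZ !mass_path_prob; try by move=> w; have [] := thetaP w.
rewrite (weight_child theta (edge0 v)) weight_child !mulrA.
by rewrite !lnM ?posrE ?mulr_gt0 ?weight_gt0 //; ring.
Qed.

Definition to_log_odds eta : 'rV[R]_d :=
  vec (log_odds (path_prob (exp_label eta))).

(** The probability of the path that goes to [u] and then always takes the
    first edge. *)
Definition first_leaf_weight lambda (u : T) : R :=
  weight (softmax lambda) (first_leaf u).

Definition of_log_odds lambda : 'rV[R]_d :=
  vec (fun v j => ln (first_leaf_weight lambda (child v j)) -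
                  ln (first_leaf_weight lambda (sval v))).

Lemma first_leaf_weight_gt0 lambda u : 0 < first_leaf_weight lambda u.
Proof. by apply: weight_gt0 => v j; exact: softmax_gt0. Qed.

Lemma softmax_to_log_odds eta :
  softmax (to_log_odds eta) = cond_prob (path_prob (exp_label eta)).
Proof.
apply: softmax_log_odds => x; apply: path_prob_gt0 => v j.
exact: exp_label_gt0.
Qed.

(** The labels [exp_label (of_log_odds lambda)] are the quotients of
    [first_leaf_weight], which is constant along first edges and equals the path
    probability at a leaf; telescoping gives proportionality. *)
Lemma path_prob_of_log_odds lambda x :
  path_prob (exp_label (of_log_odds lambda)) x =
  (first_leaf_weight lambda (root T))^-1 * path_prob (softmax lambda) x.
Proof.
set F := first_leaf_weight lambda.
have -> : exp_label (of_log_odds lambda) =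
    fun v j => F (child v j) / F (sval v).
  apply: functional_extensionality_dep => v; apply: funext => j.
  rewrite /exp_label coord_vec //; last first.
    by rewrite /F /first_leaf_weight first_leaf_child subrr.
  by rewrite expRB !lnK // posrE first_leaf_weight_gt0.
rewrite path_prob_weight weight_telescope => [|w]; last first.
  by rewrite gt_eqF ?first_leaf_weight_gt0.
rewrite path_prob_weight [LHS]mulrC; congr (_ * _).
by rewrite /F /first_leaf_weight first_leaf_id ?goal_leaf.
Qed.

(** The conditional probabilities of the log-linear weights [exp_label eta] give
    the path to the first leaf below [u] the normalised product of the labels
    leading to [u], all later labels being 1.  The quotient for the [j]-th child
    of [v] and for [v] is therefore the label of the edge between them. *)
Lemma to_log_oddsK : cancel to_log_odds of_log_odds.
Proof.
move=> eta; apply/rowP => i; rewrite mxE -[RHS]coord_e.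
case: (e i) (edge_index_bounds i) => v j /= /andP[_ jv].
have p0 x : 0 < path_prob (exp_label eta) x.
  by apply: path_prob_gt0 => *; exact: exp_label_gt0.
have FE u : first_leaf_weight (to_log_odds eta) u =
    weight (exp_label eta) u / \sum_x path_prob (exp_label eta) x.
  rewrite /first_leaf_weight softmax_to_log_odds.
  have [x xu] := leaf_goal (first_leaf_leaf u).
  rewrite -xu -path_prob_weight path_prob_cond // path_prob_weight xu.
  rewrite weight_first_leaf // => w.
  by rewrite /exp_label coord0 expR0.
have s0 : 0 < \sum_x path_prob (exp_label eta) x by rewrite -mass_root mass_gt0.
have w0 u : 0 < weight (exp_label eta) u.
  by apply: weight_gt0 => *; exact: expR_gt0.
rewrite !FE (weight_child _ (Ordinal jv)).
rewrite !ln_div ?lnM ?posrE ?mulr_gt0 ?expR_gt0 //.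
by rewrite expRK; ring.
Qed.

(** Log-odds ignore the constant of proportionality in
    [path_prob_of_log_odds]. *)
Lemma of_log_oddsK : cancel of_log_odds to_log_odds.
Proof.
move=> lambda; apply/rowP => i; rewrite mxE -[RHS]coord_e.
case: (e i) (edge_index_bounds i) => v j /= /andP[_ jv].
rewrite (funext (path_prob_of_log_odds lambda)).
rewrite (log_odds_path_prob (Ordinal jv)) //; last 2 first.
- by rewrite invr_gt0 first_leaf_weight_gt0.
- exact: softmax_params.
by rewrite -coord_softmax.
Qed.

Lemma elementary_path_prob (D : nat) (theta : 'rV[R]_D -> labelling R T) x :
  (forall v j, elementary (fun y => theta y v j)) ->
  elementary (fun y => path_prob (theta y) x).
Proof.
move=> etheta; do 2!apply: elementary_prod => ? _.
exact: elementaryX.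
Qed.

Lemma elementary_to_log_odds i : elementary (fun eta => to_log_odds eta 0 i).
Proof.
have emass u : elementary (fun eta => ln (mass (path_prob (exp_label eta)) u)).
  apply: elementary_ln => [eta|].
    by apply: mass_gt0 => x; apply: path_prob_gt0 => v j; exact: exp_label_gt0.
  apply: elementary_sum => x _; apply: elementary_path_prob => v j.
  by apply: elementary_expR; exact: elementary_coordE.
apply: (@elementary_ext _ _ _ _ _ (elementaryB (emass _) (emass _))) => eta.
by rewrite mxE.
Qed.

Lemma elementary_of_log_odds i :
  elementary (fun lambda => of_log_odds lambda 0 i).
Proof.
have eF u : elementary (fun lambda => ln (first_leaf_weight lambda u)).
  apply: elementary_ln => [lambda|]; first exact: first_leaf_weight_gt0.
  do 2!apply: elementary_prod => ? _; apply: elementaryX; apply: elementaryM.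
    by apply: elementary_expR; exact: elementary_coordE.
  apply: elementaryV => [lambda|]; first exact: softmax_sum_gt0.
  apply: elementary_sum => k _; apply: elementary_expR.
  exact: elementary_coordE.
apply: (@elementary_ext _ _ _ _ _ (elementaryB (eF _) (eF _))) => lambda.
by rewrite mxE.
Qed.

Variable x0 : leaf_path T.

Definition tree_family : exp_family R (leaf_path T) d :=
  log_linear_family x0 edge_counts.

Lemma density_tree_family eta :
  density tree_family eta = path_prob (softmax (to_log_odds eta)).
Proof.
have p0 x : 0 < path_prob (exp_label eta) x.
  by apply: path_prob_gt0 => *; exact: exp_label_gt0.
apply: funext => x; rewrite softmax_to_log_odds path_prob_cond //=.
rewrite log_linear_densityE // expR_dotp_edge_counts; congr (_ / _).
by apply: eq_bigr => y _; rewrite expR_dotp_edge_counts.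
Qed.

Lemma tree_family_surj (theta : labelling R T) : tree_params theta ->
  density tree_family (of_log_odds (vec (log_odds (path_prob theta)))) =
  path_prob theta.
Proof.
move=> thetaP; rewrite density_tree_family of_log_oddsK softmax_log_odds.
  by rewrite cond_prob_path_prob.
by move=> x; apply: path_prob_gt0 => v j; have [_ /(_ j)/andP[]] := thetaP v.
Qed.

End Coordinates.

(** * Straightening the stage equations *)

(** The edges at vertices that satisfy [P] come first, as a slice chart makes
    the last coordinates vanish. *)
Lemma edges_enumeration (T : rooted_tree) (P : pred (inner T)) :
  exists (d m : nat) (e : 'I_d -> inner T * nat),
    [/\ (m <= d)%N, injective e,
        forall v j, (0 < j < kappa v)%N <-> exists i, e i = (v, j) &
        forall i : 'I_d, (m <= i)%N = ~~ P (e i).1].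
Proof.
pose es := [seq (v, j) | v <- enum (inner T), j <- iota 1 (kappa v).-1].
have mem_es v j : ((v, j) \in es) = (0 < j < kappa v)%N.
  apply/allpairsPdep/idP => [[v' [j' [_ + [-> ->]]]]|jv].
    by rewrite mem_iota add1n prednK ?kappa_gt0.
  by exists v, j; rewrite mem_enum mem_iota add1n prednK ?kappa_gt0.
have es_uniq : uniq es.
  apply: allpairs_uniq_dep => [|v _|]; [exact: enum_uniq|exact: iota_uniq|].
  by move=> [? ?] [? ?] _ _ /= [-> ->].
pose reps := [seq p <- es | P p.1]; pose others := [seq p <- es | ~~ P p.1].
pose s := reps ++ others.
have sP : perm_eq s es by rewrite (permEl (perm_filterC (fun p => P p.1) es)).
exists (size s), (size reps), (tnth (in_tuple s)); split.
- by rewrite size_cat leq_addr.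
- by apply/tuple_uniqP; rewrite (perm_uniq sP).
- move=> v j; rewrite -mem_es -(perm_mem sP).
  by split=> [/(tnthP (in_tuple s))[i ->]|[i <-]]; [exists i|exact: mem_tnth].
- move=> i; have p := tnth (in_tuple s) i.
  rewrite (tnth_nth p) /= nth_cat ltnNge; case: leqP => mi /=.
    have : nth p others (i - size reps) \in others.
      by rewrite mem_nth // ltn_subLR // -size_cat.
    by rewrite mem_filter => /andP[].
  by have := mem_nth p mi; rewrite mem_filter => /andP[->].
Qed.

Section Straightening.
(* [r] picks a representative of each class of vertices; the first [m]
   coordinates belong to the edges of representatives. *)
Variables (R : realType) (T : rooted_tree) (d m : nat).
Variables (e : 'I_d -> inner T * nat) (r : inner T -> inner T).
Hypothesis e_inj : injective e.
Hypothesis e_edge : forall v j, (0 < j < kappa v)%N <-> exists i, e i = (v, j).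
Hypothesis r_idem : forall v, r (r v) = r v.
Hypothesis r_kappa : forall v, kappa (r v) = kappa v.
Hypothesis m_rep : forall i : 'I_d, (m <= i)%N = (r (e i).1 != (e i).1).

(** Only coordinates of vertices that are not representatives move, and by an
    amount that depends on representatives only: this makes [shear (- c)] the
    inverse of [shear c]. *)
Definition shear (c : R) (lambda : 'rV[R]_d) : 'rV[R]_d :=
  \row_i (lambda 0 i +
          if (m <= i)%N then c * coord e lambda (r (e i).1) (e i).2 else 0).

Lemma coord_shear_rep c lambda i :
  coord e (shear c lambda) (r (e i).1) (e i).2 =
  coord e lambda (r (e i).1) (e i).2.
Proof.
have := edge_index_bounds e_edge i; rewrite -r_kappa => /e_edge[k].
case ek: (e k) => [v j] [vE jE]; rewrite -vE -jE.
have := coord_e e_inj (shear c lambda) k; have := coord_e e_inj lambda k.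
by rewrite ek => -> ->; rewrite mxE m_rep ek vE r_idem eqxx addr0.
Qed.

Lemma shearK c : cancel (shear c) (shear (- c)).
Proof.
move=> lambda; apply/rowP => i; rewrite mxE coord_shear_rep mxE.
by case: ifP => _; rewrite ?addr0 // mulNr addrK.
Qed.

Lemma elementary_shear c i : elementary (fun lambda => shear c lambda 0 i).
Proof.
case mi: (m <= i)%N; last first.
  apply: elementary_ext (elementary_coord _ i) => lambda.
  by rewrite mxE mi addr0.
apply: (@elementary_ext _ _ (fun lambda : 'rV[R]_d => lambda 0 i +
    c * coord e lambda (r (e i).1) (e i).2)) => [lambda|].
  by rewrite mxE mi.
apply: elementaryD (elementary_coord _ i) _.
by apply: elementaryM; [exact: elementary_cst|exact: elementary_coordE].
Qed.

Lemma shear_slice lambda :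
  (forall i : 'I_d, (m <= i)%N -> shear (-1) lambda 0 i = 0) <->
  (forall v j, (j < kappa v)%N -> coord e lambda v j = coord e lambda (r v) j).
Proof.
split=> [slice v [|j] jv|reps i mi].
- by rewrite !coord0.
- have [i ei] : exists i, e i = (v, j.+1) by apply/e_edge.
  have lambda_i : lambda 0 i = coord e lambda v j.+1.
    by have := coord_e e_inj lambda i; rewrite ei.
  have [mi|mi] := boolP (m <= i)%N.
    have := slice i mi; rewrite mxE mi ei lambda_i mulN1r => /eqP.
    by rewrite subr_eq0 => /eqP.
  by move: mi; rewrite m_rep ei /= negbK => /eqP ->.
- have /andP[_ jv] := edge_index_bounds e_edge i.
  by rewrite mxE mi -(coord_e e_inj lambda i) reps // mulN1r subrr.
Qed.

End Straightening.

Section StagedTree.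
Variables (R : realType) (S : staged_tree R).
Implicit Types v s : inner S.

Definition stage_rep v : inner S := odflt v [pick s | stage v s].

Lemma stage_refl v : stage v v.
Proof. by have [] := stage_equiv v v v. Qed.

Lemma stage_rep_stage v : stage v (stage_rep v).
Proof.
rewrite /stage_rep; case: pickP => [s //|/(_ v)].
by rewrite stage_refl.
Qed.

Lemma stage_rep_eq v s : stage v s -> stage_rep v = stage_rep s.
Proof.
move=> vs; rewrite /stage_rep.
have vsE : stage v =1 stage s.
  by move=> w; have [_ /(_ vs)] := stage_equiv v s w.
rewrite (eq_pick vsE).
by case: pickP => [//|/(_ s)]; rewrite stage_refl.
Qed.

Lemma stage_repK v : stage_rep (stage_rep v) = stage_rep v.
Proof. by apply/esym/stage_rep_eq; exact: stage_rep_stage. Qed.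

Lemma stage_kappa v s : stage v s -> kappa v = kappa s.
Proof. by move=> /stageP[]. Qed.

Variables (d : nat) (e : 'I_d -> inner S * nat).
Hypothesis e_inj : injective e.
Hypothesis e_edge : forall v j, (0 < j < kappa v)%N <-> exists i, e i = (v, j).

(** A label is the exponential of a log-odds up to a normalising constant that
    depends on the vertex, so equal log-odds and equal labels mean the same. *)
Lemma softmax_staged (lambda : 'rV[R]_d) :
  staged_params (softmax e lambda) <->
  (forall v j, (j < kappa v)%N ->
     coord e lambda v j = coord e lambda (stage_rep v) j).
Proof.
split=> [[_ staged] v j jv|reps].
  have [kv vE] := staged _ _ (stage_rep_stage v).
  have jr : (j < kappa (stage_rep v))%N by rewrite -kv.
  rewrite (coord_softmax e_edge lambda (Ordinal jv)).
  rewrite (coord_softmax e_edge lambda (Ordinal jr)).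
  by rewrite (vE (Ordinal jv) (Ordinal jr)) // (vE (edge0 _) (edge0 _)).
split=> [|v s vs]; first exact: softmax_params.
have kvs := stage_kappa vs; split=> // j j' jj'.
have vsE k : (k < kappa v)%N -> coord e lambda v k = coord e lambda s k.
  move=> kv; rewrite reps // (stage_rep_eq vs) -reps //.
  by rewrite -kvs.
rewrite /softmax vsE // jj'; congr (_ / _).
rewrite -!(big_mkord xpredT (fun k => expR (coord e lambda _ k))) -kvs.
by apply: eq_big_nat => k kv; rewrite vsE.
Qed.

(** The labels of a path distribution are unique, so a density lies in the model
    only through its own conditional probabilities. *)
Lemma density_staged (x0 : leaf_path S) (eta : 'rV[R]_d) :
  staged_tree_model S (density (tree_family R e x0) eta) <->
  staged_params (softmax e (to_log_odds e eta)).
Proof.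
rewrite density_tree_family //; split=> [[theta thetaS]|]; last first.
  by exists (softmax e (to_log_odds e eta)).
move=> /(congr1 (@cond_prob _ _)); rewrite !cond_prob_path_prob.
- by move=> <-.
- exact: softmax_params.
- by case: thetaS.
Qed.

End StagedTree.

Theorem theorem1 (R : realType) (T : staged_tree R) :
  curved_exponential_family (staged_tree_model T).
Proof.
have [d [m [e [md e_inj e_edge m_rep]]]] :=
  edges_enumeration [pred v : inner T | stage_rep v == v].
have [x0 _] := leaf_goal (first_leaf_leaf (root T)).
pose F := tree_family R e x0.
exists d, F; split.
- exact: log_linear_regular.
- move=> _ [theta [thetaP _] <-].
  exists (of_log_odds e (vec e (log_odds (path_prob theta)))) => //.
  exact: tree_family_surj.
- by rewrite log_linear_natural_space.
have kappa_rep (v : inner T) : kappa (stage_rep v) = kappa v.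
  exact/esym/stage_kappa/stage_rep_stage.
have imageE eta : natural_image F (staged_tree_model T) eta <->
    staged_tree_model T (density F eta).
  by split=> [[_ [_ ?] <-]|?] //; exists eta.
exists m => // a _; exists setT, setT,
  (shear m e (@stage_rep R T) (-1) \o to_log_odds e),
  (of_log_odds e \o shear m e (@stage_rep R T) 1); split=> //.
- apply: elementary_diffeo.
  + apply: can_comp (to_log_oddsK e_inj e_edge) => lambda.
    have := shearK e_inj e_edge (@stage_repK R T) kappa_rep m_rep (-1) lambda.
    by rewrite opprK.
  + apply: can_comp (of_log_oddsK e_inj e_edge) _.
    exact: shearK e_inj e_edge (@stage_repK R T) kappa_rep m_rep 1.
  + move=> i; apply: (elementary_comp (elementary_shear _ _ _ _ _)) => k.
    exact: elementary_to_log_odds.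
  + move=> i; apply: (elementary_comp (elementary_of_log_odds R e i)) => k.
    exact: elementary_shear.
move=> eta _; apply: (iff_trans (imageE eta)).
apply: (iff_trans (@density_staged R T d e e_inj e_edge x0 eta)).
apply: (iff_trans (softmax_staged e_edge _)); apply: iff_sym.
exact: shear_slice e_inj e_edge m_rep _.
Qed.
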